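(* Let $\mathbb{A}$ be a PCA and $\mathbb{A}'$ an elementary sub-PCA of $\mathbb{A}$. For every partitioned assembly $(X,\varphi)$ there is an isomorphism of posets, natural in $(X,\varphi)\in\mathsf{ParAsm}(\mathbb{A},\mathbb{A}')$, $$\mathfrak{iR}(X,\varphi)\cong\mathfrak{eW}(X,\varphi).$$ Thus the doctrine of instance reducibilities $\mathfrak{iR}$ and the extended Weihrauch doctrine $\mathfrak{eW}$ are isomorphic doctrines.
   Context: The Axiom of Choice is assumed. **PCAs.** A partial combinatory algebra (PCA) is a set $\mathbb{A}$ with a partial binary operation $(a,b)\mapsto a\cdot b=ab$ (associating to the left) for which there are $\mathsf{k},\mathsf{s}\in\mathbb{A}$ such that for all $a,b,c$: $\mathsf{k}ab=a$; $\mathsf{s}ab$ is defined; $\mathsf{s}abc\simeq ac(bc)$. An elementary sub-PCA is a subset $\mathbb{A}'\subseteq\mathbb{A}$ closed under defined applications and containing such elements $\mathsf{k},\mathsf{s}$; we fix $\mathsf{k},\mathsf{s}\in\mathbb{A}'$, and from them pairing and projection combinators in $\mathbb{A}'$, writing $\langle a,b\rangle$ for the pair, with $\mathsf{p}_1\langle a,b\rangle=a$, $\mathsf{p}_2\langle a,b\rangle=b$. Writing ''$t\in S$'' for an expression $t$ includes the assertion that $t$ is defined. **Partitioned assemblies.** $\mathsf{ParAsm}(\mathbb{A},\mathbb{A}')$ has as objects pairs $(X,\varphi)$ with $X$ a set and $\varphi:X\to\mathbb{A}$ a function; a morphism $(X,\varphi)\to(Y,\psi)$ is a function $f:X\to Y$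 for which there is $a\in\mathbb{A}'$ with $a\cdot\varphi(x)$ defined and equal to $\psi(f(x))$ for all $x\in X$. This category has finite limits. **The doctrine $\mathfrak{iR}:\mathsf{ParAsm}(\mathbb{A},\mathbb{A}')^{\mathrm{op}}\to\mathsf{InfSl}$** ($\mathsf{InfSl}$ is the category of inf-semilattices). Elements of $\mathfrak{iR}(X,\varphi)$ are (classes of) pairs $((Y,\psi)\xrightarrow{f}(X,\varphi),\alpha)$ with $f$ a morphism of $\mathsf{ParAsm}(\mathbb{A},\mathbb{A}')$ and $\alpha:Y\to\wp(\mathbb{A})$ a function. One sets $((Y,\psi)\xrightarrow{f}(X,\varphi),\alpha)\le((Z,\eta)\xrightarrow{g}(X,\varphi),\beta)$ iff there are a morphism $h:(Y,\psi)\to(Z,\eta)$ with $f=g\circ h$ and an $\ell\in\mathbb{A}'$ such that for all $y\in Y$ and $q\in\beta(h(y))$, $\ell\cdot\langle\psi(y),q\rangle\in\alpha(y)$; equivalent pairs are identified. For $h:(X',\varphi')\to(X,\varphi)$, $\mathfrak{iR}_h(f,\alpha)=(h^*f,\alpha\circ f^*h)$, where $h^*f:(P,\pi)\to(X',\varphi')$ and $f^*h:(P,\pi)\to(Y,\psi)$ are the projections of the pullback of $f$ and $h$. **The extended Weihrauch doctrine $\mathfrak{eW}:\mathsf{ParAsm}(\mathbb{A},\mathbb{A}')^{\mathrm{op}}\to\mathsf{InfSl}$.** Elements of $\mathfrak{eW}(X,\varphi)$ are (classes of) functions $f:X\times\mathbb{A}\to\wp(\wp(\mathbb{A}))$. One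 sets $f\le_{\mathsf{extW}}g$ iff there exist $\ell_1,\ell_2\in\mathbb{A}'$ such that for every $(x,a)\in X\times\mathbb{A}$ with $f(x,a)\neq\emptyset$: (i) $\ell_1\cdot\langle\varphi(x),a\rangle$ is defined and $g(x,\ell_1\cdot\langle\varphi(x),a\rangle)\neq\emptyset$; (ii) for every $A\in f(x,a)$ there is $B\in g(x,\ell_1\cdot\langle\varphi(x),a\rangle)$ such that for every $q\in B$, $\ell_2\cdot\langle a,q\rangle\in A$. $\mathfrak{eW}(X,\varphi)$ is the poset reflection of $(\wp(\wp(\mathbb{A}))^{X\times\mathbb{A}},\le_{\mathsf{extW}})$. For $h:(Y,\psi)\to(X,\varphi)$, $\mathfrak{eW}_h(g)$ is the function $(y,a)\mapsto g(h(y),\mathsf{p}_2a)$ if $\mathsf{p}_1a=\psi(y)$, and $(y,a)\mapsto\emptyset$ otherwise. Two doctrines on the same base category are isomorphic if they are naturally isomorphic as functors.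
   Formalization: The relation ≤_extW as displayed is reflexive but not transitive in general (ℓ2 sees only ⟨a,q⟩, not φ(x)), so its poset reflection is taken to be that of the preorder it generates (its reflexive-transitive closure). *)

(* Defs.v *)
From Stdlib Require Import Arith Relations FunctionalExtensionality
  PropExtensionality ProofIrrelevance ClassicalEpsilon.

Set Implicit Arguments.
Unset Strict Implicit.
Unset Printing Implicit Defensive.

Record category := Category {
  ob :> Type;
  hom : ob -> ob -> Type;
  idm : forall X, hom X X;
  comp : forall X Y Z, hom Y Z -> hom X Y -> hom X Z;
  comp_idl : forall X Y (f : hom X Y), comp (idm Y) f = f;
  comp_idr : forall X Y (f : hom X Y), comp f (idm X) = f;
  comp_assoc : forall X Y Z W (h : hom Z W) (g : hom Y Z) (f : hom X Y),
    comp h (comp g f) = comp (comp h g) f }.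

Arguments hom {c} _ _.
Arguments idm {c} _.
Arguments comp {c X Y Z} _ _.

Definition opposite (C : category) : category :=
  @Category C (fun X Y => @hom C Y X) (@idm C)
    (fun X Y Z g f => @comp C Z Y X f g)
    (fun X Y f => comp_idr f) (fun X Y f => comp_idl f)
    (fun X Y Z W h g f => eq_sym (comp_assoc f g h)).

Record functor (C D : category) := Functor {
  fob :> C -> D;
  fmap : forall X Y, hom X Y -> hom (fob X) (fob Y);
  fmap_id : forall X, fmap (idm X) = idm (fob X);
  fmap_comp : forall X Y Z (g : hom Y Z) (f : hom X Y),
    fmap (comp g f) = comp (fmap g) (fmap f) }.

Arguments fmap {C D} _ {X Y} _.

Record nat_iso (C D : category) (F G : functor C D) := NatIso {
  ni_to : forall X, hom (F X) (G X);
  ni_from : forall X, hom (G X) (F X);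
  ni_toK : forall X, comp (ni_from X) (ni_to X) = idm (F X);
  ni_fromK : forall X, comp (ni_to X) (ni_from X) = idm (G X);
  ni_natural : forall X Y (f : hom X Y),
    comp (ni_to Y) (fmap F f) = comp (fmap G f) (ni_to X) }.

Record preorder := Preorder {
  pcar :> Type;
  ple : pcar -> pcar -> Prop;
  ple_refl : forall x, ple x x;
  ple_trans : forall x y z, ple x y -> ple y z -> ple x z }.

Arguments ple {p} _ _.

Definition peq (P : preorder) (x y : P) : Prop := ple x y /\ ple y x.

Definition is_top (P : preorder) (t : P) : Prop := forall x, ple x t.

Definition is_meet (P : preorder) (x y m : P) : Prop :=
  ple m x /\ ple m y /\ forall z, ple z x -> ple z y -> ple z m.

Record infsl := InfSlOb {
  isl_pre :> preorder;
  isl_antisym : forall x y : isl_pre, ple x y -> ple y x -> x = y;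
  isl_top : exists t : isl_pre, is_top t;
  isl_meet : forall x y : isl_pre, exists m, is_meet x y m }.

Record infsl_hom (P Q : infsl) := InfSlHom {
  ihom :> P -> Q;
  ihom_mono : forall x y, ple x y -> ple (ihom x) (ihom y);
  ihom_top : forall t, is_top t -> is_top (ihom t);
  ihom_meet : forall x y m, is_meet x y m -> is_meet (ihom x) (ihom y) (ihom m) }.

Lemma infsl_hom_ext (P Q : infsl) (f g : infsl_hom P Q) :
  (forall x, f x = g x) -> f = g.
Proof.
destruct f as [f f1 f2 f3], g as [g g1 g2 g3]; simpl; intros E.
apply functional_extensionality in E; subst g.
f_equal; apply proof_irrelevance.
Qed.

Definition infsl_id (P : infsl) : infsl_hom P P.
Proof. now exists (fun x => x). Defined.

Definition infsl_comp (P Q R : infsl) (g : infsl_hom Q R) (f : infsl_hom P Q) :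
  infsl_hom P R.
Proof.
exists (fun x => g (f x)).
- intros x y H; now apply ihom_mono, ihom_mono.
- intros t H; now apply ihom_top, ihom_top.
- intros x y m H; now apply ihom_meet, ihom_meet.
Defined.

Definition InfSl : category.
Proof.
refine (@Category infsl infsl_hom infsl_id infsl_comp _ _ _);
  intros; now apply infsl_hom_ext.
Defined.

Definition doctrine (C : category) := functor (opposite C) InfSl.

Definition isomorphic_doctrines (C : category) (D E : doctrine C) : Prop :=
  inhabited (nat_iso D E).

Definition poset_iso (P Q : preorder) (f : P -> Q) : Prop :=
  (forall x y, ple x y <-> ple (f x) (f y)) /\
  exists g : Q -> P, (forall x, g (f x) = x) /\ (forall y, f (g y) = y).

Record pclass (P : preorder) := PClass {
  cls :> P -> Prop;
  cls_rep : exists x, cls = peq x }.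

Definition class_of (P : preorder) (x : P) : pclass P :=
  PClass (ex_intro _ x eq_refl).

Definition pclass_le (P : preorder) (c d : pclass P) : Prop :=
  exists x y, c x /\ d y /\ ple x y.

Lemma peq_refl (P : preorder) (x : P) : peq x x.
Proof. split; apply ple_refl. Qed.

Lemma pclass_ext (P : preorder) (c d : pclass P) :
  (forall x, c x <-> d x) -> c = d.
Proof.
destruct c as [c hc], d as [d hd]; simpl; intros E.
assert (c = d) by (apply functional_extensionality; intro; now apply propositional_extensionality).
subst d; f_equal; apply proof_irrelevance.
Qed.

Lemma pclassP (P : preorder) (c : pclass P) : exists x, c = class_of x.
Proof.
destruct (cls_rep c) as [x E]; exists x.
apply pclass_ext; intro y; now rewrite E.
Qed.

Lemma pclass_leE (P : preorder) (x y : P) :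
  pclass_le (class_of x) (class_of y) <-> ple x y.
Proof.
split.
- intros (x' & y' & [H1 _] & [_ H2] & H).
  now apply ple_trans with x'; [|apply ple_trans with y'].
- intros H; exists x, y; repeat split; try apply ple_refl; exact H.
Qed.

Lemma class_of_eq (P : preorder) (x y : P) : class_of x = class_of y <-> peq x y.
Proof.
split.
- intros E; change (class_of x y); rewrite E; apply peq_refl.
- intros [H1 H2]; apply pclass_ext; intro z; simpl; split; intros [H3 H4]; split;
    eapply ple_trans; eassumption.
Qed.

Definition reflection (P : preorder) : preorder.
Proof.
refine (@Preorder (pclass P) (@pclass_le P) _ _).
- intros c; destruct (pclassP c) as [x ->]; apply pclass_leE, ple_refl.
- intros c d e; destruct (pclassP c) as [x ->], (pclassP d) as [y ->], (pclassP e) as [z ->].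
  rewrite !pclass_leE; apply ple_trans.
Defined.

Lemma reflection_antisym (P : preorder) (c d : reflection P) :
  ple c d -> ple d c -> c = d.
Proof.
destruct (pclassP c) as [x ->], (pclassP d) as [y ->].
simpl; rewrite !pclass_leE; intros; now apply class_of_eq.
Qed.

Lemma reflection_top (P : preorder) (t : P) :
  is_top (P := reflection P) (class_of t) <-> is_top t.
Proof.
split.
- intros H x; apply pclass_leE, (H (class_of x)).
- intros H c; destruct (pclassP c) as [x ->]; apply pclass_leE, H.
Qed.

Lemma reflection_meet (P : preorder) (x y m : P) :
  is_meet (P := reflection P) (class_of x) (class_of y) (class_of m)
  <-> is_meet x y m.
Proof.
unfold is_meet; simpl; rewrite !pclass_leE; split; intros (H1 & H2 & H3);
  repeat split; auto.
- intros z; rewrite <- !(pclass_leE z); apply (H3 (class_of z)).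
- intros c; destruct (pclassP c) as [z ->]; rewrite !pclass_leE; apply H3.
Qed.

Definition pclass_map (P Q : preorder) (f : P -> Q)
  (fm : forall x y, ple x y -> ple (f x) (f y)) (c : pclass P) : pclass Q.
Proof.
exists (fun z => exists x, c x /\ peq (f x) z).
destruct (pclassP c) as [x ->]; exists (f x).
apply functional_extensionality; intro z; apply propositional_extensionality.
simpl; split.
- intros (x' & [H1 H2] & [H3 H4]); split; eauto using ple_trans.
- intros H; exists x; split; [apply peq_refl | exact H].
Defined.

Lemma pclass_mapE (P Q : preorder) (f : P -> Q) fm (x : P) :
  @pclass_map P Q f fm (class_of x) = class_of (f x).
Proof.
apply pclass_ext; intro z; simpl; split.
- intros (x' & [H1 H2] & [H3 H4]); split; eauto using ple_trans.
- intros H; exists x; split; [apply peq_refl | exact H].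
Qed.

(* Preorder-valued data, functorial and inf-preserving up to [peq]; passing to
  classes gives a doctrine.  Existence of infima in the fibres and their
  preservation by reindexing are properties, witnessed here by [pd_top] and
  [pd_meet]. *)

Record predoctrine (C : category) := PreDoctrine {
  pd_ob :> C -> preorder;
  pd_map : forall X Y : C, hom X Y -> pd_ob Y -> pd_ob X;
  pd_mono : forall X Y (h : hom X Y) x y, ple x y -> ple (pd_map h x) (pd_map h y);
  pd_id : forall X x, peq (pd_map (idm X) x) x;
  pd_comp : forall X Y Z (h : hom Y Z) (k : hom X Y) x,
    peq (pd_map (comp h k) x) (pd_map k (pd_map h x));
  pd_top : forall X, pd_ob X;
  pd_topP : forall X, is_top (pd_top X);
  pd_map_top : forall X Y (h : hom X Y), is_top (pd_map h (pd_top Y));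
  pd_meet : forall X, pd_ob X -> pd_ob X -> pd_ob X;
  pd_meetP : forall X (x y : pd_ob X), is_meet x y (pd_meet x y);
  pd_map_meet : forall X Y (h : hom X Y) x y,
    ple (pd_meet (pd_map h x) (pd_map h y)) (pd_map h (pd_meet x y)) }.

Arguments pd_map {C} _ {X Y} _ _.

Definition pd_infsl (C : category) (D : predoctrine C) (X : C) : infsl.
Proof.
refine (@InfSlOb (reflection (D X)) (@reflection_antisym (D X)) _ _).
- exists (class_of (pd_top D X)); apply reflection_top, pd_topP.
- intros c d; destruct (pclassP c) as [x ->], (pclassP d) as [y ->].
  exists (class_of (pd_meet x y)); apply reflection_meet, pd_meetP.
Defined.

Definition pd_infsl_map (C : category) (D : predoctrine C) (X Y : C) (h : hom X Y) :
  infsl_hom (pd_infsl D Y) (pd_infsl D X).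
Proof.
refine (@InfSlHom (pd_infsl D Y) (pd_infsl D X)
          (pclass_map (f := pd_map D h) (pd_mono (p := D) h)) _ _ _).
- intros c d; destruct (pclassP c) as [x ->], (pclassP d) as [y ->].
  rewrite !pclass_mapE; simpl; rewrite !pclass_leE; apply pd_mono.
- intros c; destruct (pclassP c) as [t ->]; rewrite pclass_mapE.
  intros H; apply -> (reflection_top (P := D Y)) in H; apply reflection_top; intros z.
  apply ple_trans with (pd_map D h (pd_top D Y)); [apply pd_map_top|].
  apply pd_mono, H.
- intros c d e; destruct (pclassP c) as [x ->], (pclassP d) as [y ->], (pclassP e) as [m ->].
  rewrite !pclass_mapE; intros H; apply -> (reflection_meet (P := D Y)) in H; apply reflection_meet.
  destruct H as (H1 & H2 & H3); repeat split; try now apply pd_mono.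
  intros z Hx Hy.
  apply ple_trans with (pd_meet (pd_map D h x) (pd_map D h y)).
  + now apply pd_meetP.
  + apply ple_trans with (pd_map D h (pd_meet x y)); [apply pd_map_meet|].
    destruct (pd_meetP (p := D) x y) as (H4 & H5 & _).
    now apply pd_mono, H3.
Defined.

Definition reflect_doctrine (C : category) (D : predoctrine C) : doctrine C.
Proof.
refine (@Functor (opposite C) InfSl (pd_infsl D)
          (fun X Y h => pd_infsl_map D (X := Y) (Y := X) h) _ _).
- intros X; apply infsl_hom_ext; intros c; destruct (pclassP c) as [x ->]; simpl.
  rewrite pclass_mapE; apply class_of_eq, pd_id.
- intros X Y Z g f; apply infsl_hom_ext; intros c; destruct (pclassP c) as [x ->]; simpl.
  rewrite !pclass_mapE; apply class_of_eq, pd_comp.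
Defined.

(* Expressions are terms of type [option A], [None] meaning "undefined"; thus
  [=] on [option A] is Kleene equality, and [t = Some a] says that [t] is
  defined with value [a]. *)

Definition oapp (A : Type) (app : A -> A -> option A) (t u : option A) : option A :=
  match t, u with Some a, Some b => app a b | _, _ => None end.

Arguments oapp : simpl never.

Definition is_ks (A : Type) (app : A -> A -> option A) (k s : A) : Prop :=
  let ap := oapp app in
  forall a b c : A,
    ap (ap (Some k) (Some a)) (Some b) = Some a /\
    (exists v, ap (ap (Some s) (Some a)) (Some b) = Some v) /\
    ap (ap (ap (Some s) (Some a)) (Some b)) (Some c)
      = ap (ap (Some a) (Some c)) (ap (Some b) (Some c)).

Record pca := PCA {
  pca_car :> Type;
  pca_app : pca_car -> pca_car -> option pca_car;
  pca_ks : exists k s, is_ks pca_app k s }.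

Notation "t • u" := (oapp (@pca_app _) t u) (at level 40, left associativity).

Record subpca (A : pca) := SubPCA {
  sub_mem :> A -> Prop;
  sub_app : forall a b c, sub_mem a -> sub_mem b -> pca_app a b = Some c -> sub_mem c;
  sub_k : A;
  sub_s : A;
  sub_k_mem : sub_mem sub_k;
  sub_s_mem : sub_mem sub_s;
  sub_ks : is_ks (@pca_app A) sub_k sub_s }.

(* Any choice of pairing combinators in [A'] is allowed; [pairing_exists] below
   builds one from [k] and [s]. [pair a b] is the (defined) value of [p a b]. *)
Record pairing (A : pca) (A' : subpca A) := Pairing {
  pr_p : A;
  pr_1 : A;
  pr_2 : A;
  pr_p_mem : A' pr_p;
  pr_1_mem : A' pr_1;
  pr_2_mem : A' pr_2;
  pair : A -> A -> A;
  pairE : forall a b, Some pr_p • Some a • Some b = Some (pair a b);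
  pr_1E : forall a b, Some pr_1 • Some (pair a b) = Some a;
  pr_2E : forall a b, Some pr_2 • Some (pair a b) = Some b }.

Arguments pair {A A'} _ _ _.

Inductive term (A : Type) := V (n : nat) | K (a : A) | Ap (t u : term A).
Arguments V {A} n.

Section Completeness.
Variables (A : pca) (A' : subpca A).

Fixpoint eval (e : nat -> A) (t : term A) : option A :=
  match t with
  | V n => Some (e n)
  | K a => Some a
  | Ap t u => eval e t • eval e u
  end.

Fixpoint over (t : term A) : Prop :=
  match t with V _ => True | K a => A' a | Ap t u => over t /\ over u end.

Definition upd (e : nat -> A) (n : nat) (a : A) (m : nat) : A :=
  if Nat.eq_dec m n then a else e m.

Fixpoint abs (n : nat) (t : term A) : term A :=
  match t with
  | V m => if Nat.eq_dec m n then Ap (Ap (K (sub_s A')) (K (sub_k A'))) (K (sub_k A'))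
           else Ap (K (sub_k A')) (V m)
  | K a => Ap (K (sub_k A')) (K a)
  | Ap t u => Ap (Ap (K (sub_s A')) (abs n t)) (abs n u)
  end.

Lemma subk a b : Some (sub_k A') • Some a • Some b = Some a.
Proof. apply (sub_ks A' a b a). Qed.

Lemma subk_def a : exists v, Some (sub_k A') • Some a = Some v.
Proof.
generalize (subk a a); destruct (Some (sub_k A') • Some a); [eauto | discriminate].
Qed.

Lemma subs_def a b : exists v, Some (sub_s A') • Some a • Some b = Some v.
Proof. apply (sub_ks A' a b a). Qed.

Lemma subs a b c : Some (sub_s A') • Some a • Some b • Some c
  = (Some a • Some c) • (Some b • Some c).
Proof. apply (sub_ks A' a b c). Qed.

Lemma abs_over n t : over t -> over (abs n t).
Proof.
induction t as [m|a|t IHt u IHu]; simpl.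
- destruct Nat.eq_dec; simpl; auto using sub_k_mem, sub_s_mem.
- auto using sub_k_mem.
- intuition auto using sub_s_mem.
Qed.

Lemma abs_def e n t : exists v, eval e (abs n t) = Some v.
Proof.
induction t as [m|a|t [v Hv] u [w Hw]]; simpl.
- destruct Nat.eq_dec; [apply subs_def | apply subk_def].
- apply subk_def.
- rewrite Hv, Hw; apply subs_def.
Qed.

Lemma abs_app e n t a : eval e (abs n t) • Some a = eval (upd e n a) t.
Proof.
induction t as [m|c|t IHt u IHu]; simpl.
- unfold upd; destruct Nat.eq_dec; simpl eval.
  + rewrite subs; destruct (subk_def a) as [v Hv]; generalize (subk a v); now rewrite Hv.
  + apply subk.
- apply subk.
- destruct (abs_def e n t) as [v Hv], (abs_def e n u) as [w Hw].
  rewrite Hv, Hw, subs, <- Hv, <- Hw; congruence.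
Qed.

Lemma eval_mem e t v : (forall n, A' (e n)) -> over t -> eval e t = Some v -> A' v.
Proof.
intros He; revert v; induction t as [m|a|t IHt u IHu]; simpl; intros v.
- intros _ [= <-]; apply He.
- now intros H [= <-].
- intros [H1 H2]; destruct (eval e t) as [b|], (eval e u) as [c|]; cbn [oapp]; try discriminate.
  apply sub_app; auto.
Qed.

Lemma realize (t : term A) : over t ->
  exists l, A' l /\ forall a, Some l • Some a = eval (fun _ => a) t.
Proof.
intros H.
pose (e := fun _ : nat => sub_k A').
(* identify all variables with variable 0 *)
pose (t0 := (fix z t := match t with V _ => V 0 | K a => K a | Ap t u => Ap (z t) (z u) end) t).
assert (H0 : over t0) by (subst t0; induction t; simpl in *; intuition).
destruct (abs_def e 0 t0) as [l Hl]; exists l; split.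
- apply (@eval_mem e (abs 0 t0)); auto using abs_over.
  intros; apply sub_k_mem.
- intros a; rewrite <- Hl, abs_app; clear.
  subst t0; induction t as [m|c|t IHt u IHu]; simpl; [reflexivity..|].
  now rewrite IHt, IHu.
Qed.

Lemma pairing_exists : inhabited (pairing A').
Proof.
pose (e := fun _ : nat => sub_k A').
assert (He : forall n, A' (e n)) by (intros; apply sub_k_mem).
pose (body := @Ap A (Ap (V 2) (V 0)) (V 1)).
destruct (abs_def e 0 (abs 1 (abs 2 body))) as [p Hp].
destruct (@realize (@Ap A (V 0) (K (sub_k A')))) as [p1 [M1 E1]].
{ simpl; auto using sub_k_mem. }
assert (Hki : exists k', A' k' /\ forall a b, Some k' • Some a • Some b = Some b).
{ destruct (abs_def e 0 (abs 1 (V 1))) as [k' Hk]; exists k'; split.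
  - apply (@eval_mem e _ k') in Hk; auto. now apply abs_over, abs_over.
  - intros a b; rewrite <- Hk, !abs_app; reflexivity. }
destruct Hki as [k' [Mk Ek]].
destruct (@realize (@Ap A (V 0) (K k'))) as [p2 [M2 E2]].
{ simpl; auto. }
pose (pt a b := eval (upd (upd e 0 a) 1 b) (abs 2 body)).
pose (pr a b := match pt a b with Some v => v | None => sub_k A' end).
assert (Hpr : forall a b, Some (pr a b) = pt a b).
{ intros a b; unfold pr; unfold pt.
  destruct (abs_def (upd (upd e 0 a) 1 b) 2 body) as [v ->]; reflexivity. }
assert (Hc : forall a b c, Some (pr a b) • Some c = Some c • Some a • Some b).
{ intros a b c; rewrite Hpr; unfold pt; rewrite abs_app; reflexivity. }
constructor; refine (@Pairing A A' p p1 p2 _ M1 M2 pr _ _ _).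
- apply (@eval_mem e _ p) in Hp; auto.
  now apply abs_over, abs_over, abs_over.
- intros a b; rewrite <- Hp, Hpr, !abs_app; reflexivity.
- intros a b; rewrite E1; cbn [eval]; rewrite Hc; apply subk.
- intros a b; rewrite E2; cbn [eval]; rewrite Hc; apply Ek.
Qed.

End Completeness.

Section ParAsm.
Variables (A : pca) (A' : subpca A).

Record parasm_ob := ParAsmOb {
  pa_car :> Type;
  pa_map : pa_car -> A }.

Definition tracked (X Y : parasm_ob) (f : X -> Y) : Prop :=
  exists a, A' a /\ forall x, Some a • Some (pa_map x) = Some (pa_map (f x)).

Record parasm_hom (X Y : parasm_ob) := ParAsmHom {
  pah_fun :> X -> Y;
  pah_tracked : tracked pah_fun }.

Lemma parasm_hom_ext (X Y : parasm_ob) (f g : parasm_hom X Y) :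
  (forall x, f x = g x) -> f = g.
Proof.
destruct f as [f hf], g as [g hg]; simpl; intros E.
apply functional_extensionality in E; subst g; f_equal; apply proof_irrelevance.
Qed.

Definition parasm_id (X : parasm_ob) : parasm_hom X X.
Proof.
exists (fun x => x).
destruct (@realize A A' (V 0)) as [l [M E]]; [exact I|].
exists l; split; [exact M | intros; apply E].
Defined.

Definition parasm_comp (X Y Z : parasm_ob) (g : parasm_hom Y Z) (f : parasm_hom X Y) :
  parasm_hom X Z.
Proof.
exists (fun x => g (f x)).
destruct (pah_tracked g) as [b [Mb Eb]], (pah_tracked f) as [a [Ma Ea]].
destruct (@realize A A' (Ap (K b) (Ap (K a) (V 0)))) as [l [M E]]; [simpl; auto|].
exists l; split; [exact M | intros; rewrite E; cbn [eval]; now rewrite Ea, Eb].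
Defined.

Definition ParAsm : category.
Proof.
refine (@Category parasm_ob parasm_hom parasm_id parasm_comp _ _ _);
  intros; now apply parasm_hom_ext.
Defined.

Canonical ParAsm.

End ParAsm.

Arguments pa_map {A} _ _.

Section Doctrines.
Variables (A : pca) (A' : subpca A) (pr : pairing A').

Local Notation "⟨ a , b ⟩" := (pair pr a b).
Local Notation ParAsm := (ParAsm A').
Local Notation p1 := (pr_1 pr).
Local Notation p2 := (pr_2 pr).

(** [t ∈ S], including the assertion that [t] is defined. *)
Definition oin (t : option A) (S : A -> Prop) : Prop := exists r, t = Some r /\ S r.

Lemma mem_pair a b : A' a -> A' b -> A' ⟨a, b⟩.
Proof.
intros Ha Hb; generalize (pairE pr a b); unfold oapp.
destruct (pca_app (pr_p pr) a) as [c|] eqn:E; [|discriminate]; intros E'.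
apply (sub_app (sub_app (pr_p_mem pr) Ha E) Hb E').
Qed.

Definition tpair (t u : term A) : term A := Ap (Ap (K (pr_p pr)) t) u.
Definition t1 (t : term A) : term A := Ap (K p1) t.
Definition t2 (t : term A) : term A := Ap (K p2) t.

Local Ltac ev := cbn [eval tpair t1 t2]; repeat (rewrite pairE || rewrite pr_1E || rewrite pr_2E).
Local Ltac mem := simpl; intuition auto using pr_p_mem, pr_1_mem, pr_2_mem, mem_pair.
Local Ltac real t l M E := destruct (@realize A A' t) as [l [M E]]; [mem|].

Definition pb_ob (Y Z X : ParAsm) (f : hom Y X) (g : hom Z X) : ParAsm :=
  @ParAsmOb A {yz : pa_car Y * pa_car Z | f (fst yz) = g (snd yz)}
    (fun w => ⟨pa_map Y (fst (proj1_sig w)), pa_map Z (snd (proj1_sig w))⟩).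

Definition pb_fst (Y Z X : ParAsm) (f : hom Y X) (g : hom Z X) : hom (pb_ob f g) Y.
Proof.
exists (fun w => fst (proj1_sig w)).
exists p1; split; [apply pr_1_mem | intros; apply pr_1E].
Defined.

Definition pb_snd (Y Z X : ParAsm) (f : hom Y X) (g : hom Z X) : hom (pb_ob f g) Z.
Proof.
exists (fun w => snd (proj1_sig w)).
exists p2; split; [apply pr_2_mem | intros; apply pr_2E].
Defined.

Lemma pb_comm (Y Z X : ParAsm) (f : hom Y X) (g : hom Z X) :
  comp f (pb_fst f g) = comp g (pb_snd f g).
Proof. apply parasm_hom_ext; intros [w E]; exact E. Qed.

Lemma pb_universal (Y Z X W : ParAsm) (f : hom Y X) (g : hom Z X)
  (u : hom W Y) (v : hom W Z) : comp f u = comp g v ->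
  exists! w : hom W (pb_ob f g), comp (pb_fst f g) w = u /\ comp (pb_snd f g) w = v.
Proof.
intros E.
assert (E' : forall x, f (u x) = g (v x)).
{ intros x; change (comp f u x = comp g v x); now rewrite E. }
assert (T : tracked A' (X := W) (Y := pb_ob f g)
              (fun x => exist (fun yz => f (fst yz) = g (snd yz)) (u x, v x) (E' x))).
{ destruct (pah_tracked u) as [a [Ma Ea]], (pah_tracked v) as [b [Mb Eb]].
  real (tpair (Ap (K a) (V 0)) (Ap (K b) (V 0))) l M El.
  exists l; split; [exact M|]; intros x; rewrite El; cbn [eval tpair].
  rewrite Ea, Eb; apply pairE. }
exists (ParAsmHom T); split.
- split; now apply parasm_hom_ext.
- intros w [Hu Hv]; apply parasm_hom_ext; intros x; simpl.
  apply eq_sig_hprop; [intros; apply proof_irrelevance|]; simpl.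
  rewrite <- Hu, <- Hv; simpl; now destruct (proj1_sig (w x)).
Qed.

(* The fields mention [parasm_ob] and [parasm_hom] rather than [ParAsm] for universe
   reasons: [iR_elt X] is the carrier of a preorder, whose universe is below that of
   objects of a category. *)
Record iR_elt (X : parasm_ob A) := IRElt {
  ir_dom : parasm_ob A;
  ir_map : parasm_hom A' ir_dom X;
  ir_val : pa_car ir_dom -> (A -> Prop) }.

Definition iR_le (X : ParAsm) (r r' : iR_elt X) : Prop :=
  exists h : hom (ir_dom r) (ir_dom r'),
    ir_map r = comp (ir_map r') h /\
    exists l, A' l /\
      forall (y : pa_car (ir_dom r)) (q : A), ir_val (h y) q ->
        oin (Some l • Some ⟨pa_map (ir_dom r) y, q⟩) (ir_val y).

Lemma iR_le_refl X (r : iR_elt X) : iR_le r r.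
Proof.
exists (idm _); split; [now rewrite comp_idr|].
exists p2; split; [apply pr_2_mem|]; intros y q H.
exists q; split; [apply pr_2E | exact H].
Qed.

Lemma iR_le_trans X (r s t : iR_elt X) : iR_le r s -> iR_le s t -> iR_le r t.
Proof.
intros (h & Eh & l & Ml & Hl) (k & Ek & m & Mm & Hm).
exists (comp k h); split; [now rewrite comp_assoc, <- Ek|].
destruct (pah_tracked h) as [a [Ma Ea]].
real (Ap (K l) (tpair (t1 (V 0)) (Ap (K m) (tpair (Ap (K a) (t1 (V 0))) (t2 (V 0)))))) c Mc Ec.
exists c; split; [exact Mc|]; intros y q H.
destruct (Hm _ _ H) as (q' & E1 & H1); destruct (Hl _ _ H1) as (q'' & E2 & H2).
exists q''; split; [|exact H2].
rewrite Ec; ev; rewrite Ea; ev; rewrite E1; ev; exact E2.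
Qed.

Definition iR_preorder (X : ParAsm) : preorder :=
  Preorder (@iR_le_refl X) (@iR_le_trans X).

Definition iR_reindex (X' X : ParAsm) (h : hom X' X) (r : iR_elt X) : iR_elt X' :=
  IRElt (pb_fst h (ir_map r))
        (fun w => ir_val (pb_snd h (ir_map r) w)).

Lemma iR_reindex_le (X' X : ParAsm) (h : hom X' X) (r : iR_elt X) (s : iR_elt X')
  (u : hom (ir_dom s) (ir_dom r)) :
  comp h (ir_map s) = comp (ir_map r) u ->
  (exists l, A' l /\ forall y q, ir_val (u y) q ->
     oin (Some l • Some ⟨pa_map (ir_dom s) y, q⟩) (ir_val y)) ->
  iR_le s (iR_reindex h r).
Proof.
intros E (l & Ml & Hl).
destruct (pb_universal E) as (w & [Ew1 Ew2] & _).
exists w; split; [now symmetry|].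
exists l; split; [exact Ml|]; intros y q; simpl.
change (snd (proj1_sig (w y))) with (comp (pb_snd h (ir_map r)) w y); rewrite Ew2; apply Hl.
Qed.

Lemma iR_le_reindex (X' X : ParAsm) (h : hom X' X) (r : iR_elt X) (s : iR_elt X') :
  iR_le s (iR_reindex h r) ->
  exists u : hom (ir_dom s) (ir_dom r), comp h (ir_map s) = comp (ir_map r) u /\
  (exists l, A' l /\ forall y q, ir_val (u y) q ->
     oin (Some l • Some ⟨pa_map (ir_dom s) y, q⟩) (ir_val y)).
Proof.
intros (w & Ew & H); exists (comp (pb_snd h (ir_map r)) w); split; [|exact H].
now rewrite comp_assoc, <- pb_comm, <- comp_assoc, Ew.
Qed.

Lemma iR_reindex_mono (X' X : ParAsm) (h : hom X' X) (r s : iR_elt X) :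
  iR_le r s -> iR_le (iR_reindex h r) (iR_reindex h s).
Proof.
intros (k & Ek & l & Ml & Hl).
apply (@iR_reindex_le _ _ h s (iR_reindex h r) (comp k (pb_snd h (ir_map r)))).
- simpl ir_map; rewrite comp_assoc, <- Ek; apply pb_comm.
- real (Ap (K l) (tpair (t2 (t1 (V 0))) (t2 (V 0)))) c Mc Ec.
  exists c; split; [exact Mc|]; intros y q H.
  destruct (Hl _ _ H) as (q' & E & H').
  exists q'; split; [rewrite Ec; simpl pa_map; ev; exact E | exact H'].
Qed.

Lemma iR_reindex_id X (r : iR_elt X) : peq (P := iR_preorder X) (iR_reindex (idm X) r) r.
Proof.
split.
- exists (pb_snd (idm X) (ir_map r)); split.
  + transitivity (comp (idm X) (pb_fst (idm X) (ir_map r))); [symmetry; apply comp_idl | apply pb_comm].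
  + exists p2; split; [apply pr_2_mem|]; intros y q H.
    exists q; split; [apply pr_2E | exact H].
- apply (@iR_reindex_le _ _ (idm X) r r (idm _)).
  + now rewrite comp_idl, comp_idr.
  + exists p2; split; [apply pr_2_mem|]; intros y q H.
    exists q; split; [apply pr_2E | exact H].
Qed.

Lemma iR_reindex_comp (X Y Z : ParAsm) (h : hom Y Z) (k : hom X Y) (r : iR_elt Z) :
  peq (P := iR_preorder X) (iR_reindex (comp h k) r) (iR_reindex k (iR_reindex h r)).
Proof.
assert (idl : exists l, A' l /\ forall (y : A) q (S : A -> Prop), S q ->
  oin (Some l • Some ⟨y, q⟩) S).
{ exists p2; split; [apply pr_2_mem|]; intros y q S H.
  exists q; split; [apply pr_2E | exact H]. }
destruct idl as (l & Ml & Hl).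
split.
- destruct (@pb_universal _ _ _ (pb_ob (comp h k) (ir_map r)) h (ir_map r)
              (comp k (pb_fst (comp h k) (ir_map r))) (pb_snd (comp h k) (ir_map r)))
    as (w & [Ew1 Ew2] & _).
  { rewrite comp_assoc; apply pb_comm. }
  apply (@iR_reindex_le _ _ k (iR_reindex h r) (iR_reindex (comp h k) r) w).
  + symmetry; exact Ew1.
  + exists l; split; [exact Ml|]; intros y q H; apply Hl; revert H; simpl.
    change (snd (proj1_sig (w y))) with (comp (pb_snd h (ir_map r)) w y); now rewrite Ew2.
- apply (@iR_reindex_le _ _ (comp h k) r (iR_reindex k (iR_reindex h r))
           (comp (pb_snd h (ir_map r)) (pb_snd k (pb_fst h (ir_map r))))).
  + change (comp (comp h k) (pb_fst k (pb_fst h (ir_map r)))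
            = comp (ir_map r) (comp (pb_snd h (ir_map r)) (pb_snd k (pb_fst h (ir_map r))))).
    rewrite comp_assoc, <- pb_comm, <- !comp_assoc; f_equal; apply pb_comm.
  + exists l; split; [exact Ml|]; intros y q H; apply Hl; exact H.
Qed.

Definition iR_top (X : ParAsm) : iR_elt X :=
  IRElt (idm X) (fun _ _ => False).

Lemma iR_topP X : is_top (P := iR_preorder X) (iR_top X).
Proof.
intros r; exists (ir_map r); split; [symmetry; apply comp_idl|].
exists p2; split; [apply pr_2_mem|]; intros y q [].
Qed.

Lemma iR_reindex_top X Y (h : hom X Y) :
  is_top (P := iR_preorder X) (iR_reindex h (iR_top Y)).
Proof.
intros r; apply (@iR_reindex_le _ _ h (iR_top Y) r (comp h (ir_map r))).
- symmetry; apply comp_idl.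
- exists p2; split; [apply pr_2_mem|]; intros y q [].
Qed.

(* Fibre product of the domains, with the disjoint union of the values, tagged by
   the two projection combinators. *)
Definition iR_meet (X : ParAsm) (r s : iR_elt X) : iR_elt X :=
  IRElt (comp (ir_map r) (pb_fst (ir_map r) (ir_map s)))
    (fun w c =>
      (exists q, ir_val (pb_fst (ir_map r) (ir_map s) w) q /\ c = ⟨p1, q⟩) \/
      (exists q, ir_val (pb_snd (ir_map r) (ir_map s) w) q /\ c = ⟨p2, q⟩)).

Lemma iR_meetP X (r s : iR_elt X) : is_meet (P := iR_preorder X) r s (iR_meet r s).
Proof.
repeat split.
- exists (pb_fst _ _); split; [reflexivity|].
  real (tpair (K p1) (t2 (V 0))) l Ml El; exists l; split; [exact Ml|]; intros y q H.
  exists ⟨p1, q⟩; split; [rewrite El; ev; reflexivity | left; eauto].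
- exists (pb_snd _ _); split; [apply pb_comm|].
  real (tpair (K p2) (t2 (V 0))) l Ml El; exists l; split; [exact Ml|]; intros y q H.
  exists ⟨p2, q⟩; split; [rewrite El; ev; reflexivity | right; eauto].
- intros t (u & Eu & l & Ml & Hl) (v & Ev & m & Mm & Hm).
  destruct (@pb_universal _ _ _ _ (ir_map r) (ir_map s) u v) as (w & [Ew1 Ew2] & _).
  { now rewrite <- Eu, <- Ev. }
  exists w; split; [change (ir_map t = comp (comp (ir_map r) (pb_fst (ir_map r) (ir_map s))) w);
    now rewrite <- comp_assoc, Ew1|].
  real (Ap (Ap (t1 (t2 (V 0))) (K ⟨l, m⟩)) (tpair (t1 (V 0)) (t2 (t2 (V 0))))) c Mc Ec.
  exists c; split; [exact Mc|]; intros y q [(q' & H & ->)|(q' & H & ->)]; rewrite Ec; ev.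
  + apply Hl; rewrite <- Ew1; exact H.
  + apply Hm; rewrite <- Ew2; exact H.
Qed.

Lemma iR_reindex_meet X Y (h : hom X Y) (r s : iR_elt Y) :
  iR_le (iR_meet (iR_reindex h r) (iR_reindex h s)) (iR_reindex h (iR_meet r s)).
Proof.
set (m := iR_meet _ _).
destruct (iR_meetP (iR_reindex h r) (iR_reindex h s)) as (L1 & L2 & _); fold m in L1, L2.
destruct (iR_le_reindex L1) as (u & Eu & l & Ml & Hl).
destruct (iR_le_reindex L2) as (v & Ev & n & Mn & Hn).
destruct (@pb_universal _ _ _ _ (ir_map r) (ir_map s) u v) as (w & [Ew1 Ew2] & _).
{ now rewrite <- Eu, <- Ev. }
apply (@iR_reindex_le _ _ h (iR_meet r s) m w).
- rewrite Eu; change (comp (ir_map r) u = comp (comp (ir_map r) (pb_fst (ir_map r) (ir_map s))) w).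
  now rewrite <- comp_assoc, Ew1.
- real (Ap (Ap (t1 (t2 (V 0))) (K ⟨l, n⟩)) (tpair (t1 (V 0)) (t2 (t2 (V 0))))) c Mc Ec.
  exists c; split; [exact Mc|]; intros y q [(q' & H & ->)|(q' & H & ->)]; rewrite Ec; ev.
  + apply Hl; rewrite <- Ew1; exact H.
  + apply Hn; rewrite <- Ew2; exact H.
Qed.

Definition iR_pre : predoctrine ParAsm :=
  @PreDoctrine ParAsm iR_preorder iR_reindex iR_reindex_mono iR_reindex_id iR_reindex_comp
    iR_top iR_topP iR_reindex_top iR_meet iR_meetP iR_reindex_meet.

Definition iR : doctrine ParAsm := reflect_doctrine iR_pre.

Definition iR_poset (X : ParAsm) : infsl := iR X.

Definition iR_map (X Y : ParAsm) (h : hom Y X) : infsl_hom (iR_poset X) (iR_poset Y) :=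
  @fmap (opposite ParAsm) InfSl iR X Y h.

Definition eW_elt (X : ParAsm) : Type := pa_car X -> A -> ((A -> Prop) -> Prop).

Definition nonempty (F : (A -> Prop) -> Prop) : Prop := exists S, F S.

Definition extW_le (X : ParAsm) (f g : eW_elt X) : Prop :=
  exists l1 l2, A' l1 /\ A' l2 /\
    forall (x : pa_car X) (a : A), nonempty (f x a) ->
      exists b, Some l1 • Some ⟨pa_map X x, a⟩ = Some b /\ nonempty (g x b) /\
        forall S, f x a S -> exists T, g x b T /\
          forall q, T q -> oin (Some l2 • Some ⟨a, q⟩) S.

(* [extW_le] is reflexive but, since [l2] has no access to [pa_map X x], in
   general not transitive.  Its poset reflection is therefore that of the
   preorder it generates, described explicitly by [extW_uniform]. *)
Definition eW_preorder (X : ParAsm) : preorder :=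
  @Preorder (eW_elt X) (clos_refl_trans _ (@extW_le X)) (rt_refl _ _) (rt_trans _ _).

Definition extW_uniform (X : ParAsm) (f g : eW_elt X) : Prop :=
  exists l1 l2, A' l1 /\ A' l2 /\
    forall (x : pa_car X) (a : A), nonempty (f x a) ->
      exists b, Some l1 • Some ⟨pa_map X x, a⟩ = Some b /\ nonempty (g x b) /\
        forall S, f x a S -> exists T, g x b T /\
          forall q, T q -> oin (Some l2 • Some ⟨⟨pa_map X x, a⟩, q⟩) S.

Lemma extW_uniform_trans X (f g h : eW_elt X) :
  extW_uniform f g -> extW_uniform g h -> extW_uniform f h.
Proof.
intros (l & m & Ml & Mm & H) (l' & m' & Ml' & Mm' & H').
real (Ap (K l') (tpair (t1 (V 0)) (Ap (K l) (V 0)))) c Mc Ec.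
real (Ap (K m) (tpair (t1 (V 0)) (Ap (K m')
        (tpair (tpair (t1 (t1 (V 0))) (Ap (K l) (t1 (V 0)))) (t2 (V 0)))))) d Md Ed.
exists c, d; repeat split; auto; intros x a N.
destruct (H _ _ N) as (b & Eb & Nb & Hb), (H' _ _ Nb) as (b' & Eb' & Nb' & Hb').
exists b'; repeat split; auto.
- rewrite Ec; ev; rewrite Eb; ev; exact Eb'.
- intros S HS; destruct (Hb _ HS) as (T & HT & RT), (Hb' _ HT) as (U & HU & RU).
  exists U; split; [exact HU|]; intros q Hq.
  destruct (RU _ Hq) as (q1 & E1 & H1), (RT _ H1) as (q2 & E2 & H2).
  exists q2; split; [|exact H2].
  rewrite Ed; ev; rewrite Eb; ev; rewrite E1; ev; exact E2.
Qed.

Lemma extW_le_uniform X (f g : eW_elt X) : extW_le f g -> extW_uniform f g.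
Proof.
intros (l & m & Ml & Mm & H).
real (Ap (K m) (tpair (t2 (t1 (V 0))) (t2 (V 0)))) d Md Ed.
exists l, d; repeat split; auto; intros x a N.
destruct (H _ _ N) as (b & Eb & Nb & Hb); exists b; repeat split; auto.
intros S HS; destruct (Hb _ HS) as (T & HT & RT); exists T; split; [exact HT|].
intros q Hq; rewrite Ed; ev; now apply RT.
Qed.

Lemma extW_le_refl X (f : eW_elt X) : extW_le f f.
Proof.
exists p2, p2; repeat split; try apply pr_2_mem; intros x a N.
exists a; repeat split; [apply pr_2E | exact N |].
intros S HS; exists S; split; [exact HS|]; intros q Hq.
exists q; split; [apply pr_2E | exact Hq].
Qed.

Lemma eW_leE X (f g : eW_preorder X) : ple f g <-> extW_uniform f g.
Proof.
split.
- induction 1 as [f g H|f|f g h _ IH1 _ IH2].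
  + now apply extW_le_uniform.
  + apply extW_le_uniform, extW_le_refl.
  + now apply extW_uniform_trans with g.
- intros (l & m & Ml & Mm & H).
  pose (f0 := (fun x c S => exists a, c = ⟨pa_map X x, a⟩ /\ f x a S) : eW_elt X).
  apply rt_trans with f0; apply rt_step.
  + real (V (A := A) 0) i Mi Ei.
    exists i, p2; repeat split; auto using pr_2_mem; intros x a [S HS].
    exists ⟨pa_map X x, a⟩; repeat split.
    * apply Ei.
    * exists S, a; auto.
    * intros S' HS'; exists S'; split; [exists a; auto|].
      intros q Hq; exists q; split; [apply pr_2E | exact Hq].
  + real (Ap (K l) (t2 (V 0))) c Mc Ec.
    exists c, m; repeat split; auto; intros x b [S (a & -> & HS)].
    destruct (H x a) as (b & Eb & Nb & Hb); [now exists S|].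
    exists b; repeat split; auto.
    * rewrite Ec; ev; exact Eb.
    * intros S' (a' & E & HS').
      assert (a' = a) as ->.
      { generalize (pr_2E pr (pa_map X x) a), (pr_2E pr (pa_map X x) a'); congruence. }
      now apply Hb.
Qed.

(* The case distinction "... if p1 a = psi y, and the empty set otherwise"; the
   value is also empty when [p2 a] is undefined. *)
Definition eW_reindex (Y X : ParAsm) (h : hom Y X) (g : eW_elt X) : eW_elt Y :=
  fun y a S => Some p1 • Some a = Some (pa_map Y y) /\
    exists b, Some p2 • Some a = Some b /\ g (h y) b S.

Lemma eW_reindex_mono (Y X : ParAsm) (h : hom Y X) (f g : eW_preorder X) :
  ple f g -> ple (p := eW_preorder Y) (eW_reindex h f) (eW_reindex h g).
Proof.
rewrite !eW_leE; intros (l & m & Ml & Mm & H).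
destruct (pah_tracked h) as [t [Mt Et]].
real (tpair (t1 (V 0)) (Ap (K l) (tpair (Ap (K t) (t1 (V 0))) (t2 (t2 (V 0)))))) c Mc Ec.
real (Ap (K m) (tpair (tpair (Ap (K t) (t1 (t1 (V 0)))) (t2 (t2 (t1 (V 0))))) (t2 (V 0)))) d Md Ed.
exists c, d; repeat split; auto; intros y a (S & E1 & b & E2 & HS).
destruct (H (h y) b) as (b' & Eb & Nb & Hb); [now exists S|].
exists ⟨pa_map Y y, b'⟩; repeat split.
- rewrite Ec; ev; rewrite Et, E2; ev; rewrite Eb; ev; reflexivity.
- destruct Nb as [T HT]; exists T; split; [apply pr_1E|].
  exists b'; split; [apply pr_2E | exact HT].
- intros S' (_ & b0 & E0 & HS'); assert (b0 = b) as -> by congruence.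
  destruct (Hb _ HS') as (T & HT & RT); exists T; split.
  + split; [apply pr_1E|]; exists b'; split; [apply pr_2E | exact HT].
  + intros q Hq; rewrite Ed; ev; rewrite Et, E2; ev; now apply RT.
Qed.

(* Reductions that only transform the question, passing the same set of answers. *)
Lemma eW_le_simple X (f g : eW_preorder X) l : A' l ->
  (forall x a S, f x a S -> exists b,
     Some l • Some ⟨pa_map X x, a⟩ = Some b /\ g x b S) -> ple f g.
Proof.
intros Ml H; apply rt_step; exists l, p2; repeat split; auto using pr_2_mem.
intros x a [S HS]; destruct (H _ _ _ HS) as (b & Eb & Gb).
exists b; repeat split; [exact Eb | now exists S |].
intros S' HS'; destruct (H _ _ _ HS') as (b' & Eb' & Gb').
assert (b' = b) as -> by congruence.
exists S'; split; [exact Gb'|]; intros q Hq; exists q; split; [apply pr_2E | exact Hq].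
Qed.

Lemma eW_reindex_id X (f : eW_elt X) : peq (P := eW_preorder X) (eW_reindex (idm X) f) f.
Proof.
split.
- real (t2 (t2 (V (A := A) 0))) c Mc Ec.
  apply (@eW_le_simple X _ _ c Mc); intros x a S (_ & b & Eb & HS).
  exists b; split; [rewrite Ec; ev; exact Eb | exact HS].
- real (V (A := A) 0) c Mc Ec.
  apply (@eW_le_simple X _ _ c Mc); intros x a S HS.
  exists ⟨pa_map X x, a⟩; split; [apply Ec|].
  split; [apply pr_1E|]; exists a; split; [apply pr_2E | exact HS].
Qed.

Lemma eW_reindex_comp (X Y Z : ParAsm) (h : hom Y Z) (k : hom X Y) (f : eW_elt Z) :
  peq (P := eW_preorder X) (eW_reindex (comp h k) f) (eW_reindex k (eW_reindex h f)).
Proof.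
destruct (pah_tracked k) as [t [Mt Et]]; split.
- real (tpair (t1 (V 0)) (tpair (Ap (K t) (t1 (V 0))) (t2 (t2 (V 0))))) c Mc Ec.
  apply (@eW_le_simple X _ _ c Mc); intros x a S (_ & b & Eb & HS).
  exists ⟨pa_map X x, ⟨pa_map Y (k x), b⟩⟩; split.
  + rewrite Ec; ev; rewrite Et, Eb; ev; reflexivity.
  + split; [apply pr_1E|]; eexists; split; [apply pr_2E|].
    split; [apply pr_1E|]; exists b; split; [apply pr_2E | exact HS].
- real (tpair (t1 (V 0)) (t2 (t2 (t2 (V 0))))) c Mc Ec.
  apply (@eW_le_simple X _ _ c Mc); intros x a S (_ & b & Eb & _ & b' & Eb' & HS).
  exists ⟨pa_map X x, b'⟩; split.
  + rewrite Ec; ev; rewrite Eb; ev; rewrite Eb'; ev; reflexivity.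
  + split; [apply pr_1E|]; exists b'; split; [apply pr_2E | exact HS].
Qed.

Definition eW_top (X : ParAsm) : eW_elt X := fun _ _ S => S = (fun _ => False).

Arguments eW_top : clear implicits.

Lemma eW_topP X : is_top (P := eW_preorder X) (eW_top X).
Proof.
intros f; apply rt_step; exists p2, p2; repeat split; try apply pr_2_mem.
intros x a _; exists a; repeat split; [apply pr_2E | now eexists |].
intros S _; eexists; split; [reflexivity|]; intros q [].
Qed.

Lemma eW_reindex_top X Y (h : hom X Y) :
  is_top (P := eW_preorder X) (eW_reindex h (eW_top Y)).
Proof.
intros f; apply rt_step.
real (V (A := A) 0) c Mc Ec.
exists c, p2; repeat split; auto using pr_2_mem.
assert (T : forall x a, eW_reindex h (eW_top Y) x ⟨pa_map X x, a⟩ (fun _ => False)).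
{ intros x a; split; [apply pr_1E|]; exists a; split; [apply pr_2E | reflexivity]. }
intros x a _; exists ⟨pa_map X x, a⟩; repeat split; [apply Ec | eexists; apply T |].
intros S _; eexists; split; [apply T|]; intros q [].
Qed.

(* A question is a pair of questions, a set of answers is a disjoint union, tagged by
   the two projection combinators. *)
Definition tagged_sum (S T : A -> Prop) : A -> Prop := fun c =>
  (exists q, S q /\ c = ⟨p1, q⟩) \/ (exists q, T q /\ c = ⟨p2, q⟩).

Definition eW_meet (X : ParAsm) (f g : eW_elt X) : eW_elt X := fun x a U =>
  exists b c S T, Some p1 • Some a = Some b /\ Some p2 • Some a = Some c /\
    f x b S /\ g x c T /\ U = tagged_sum S T.

Lemma eW_meetP X (f g : eW_elt X) : is_meet (P := eW_preorder X) f g (eW_meet f g).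
Proof.
repeat split.
- apply rt_step.
  real (t1 (t2 (V (A := A) 0))) c Mc Ec; real (tpair (K p1) (t2 (V 0))) d Md Ed.
  exists c, d; repeat split; auto.
  intros x a (U & b & b' & S & T & E1 & E2 & HS & HT & EU).
  exists b; repeat split; [rewrite Ec; ev; exact E1 | now exists S |].
  intros U' (b1 & b2 & S' & T' & E1' & E2' & HS' & HT' & ->).
  assert (b1 = b) as -> by congruence.
  exists S'; split; [exact HS'|]; intros q Hq; exists ⟨p1, q⟩; split.
  + rewrite Ed; ev; reflexivity.
  + left; eauto.
- apply rt_step.
  real (t2 (t2 (V (A := A) 0))) c Mc Ec; real (tpair (K p2) (t2 (V 0))) d Md Ed.
  exists c, d; repeat split; auto.
  intros x a (U & b & b' & S & T & E1 & E2 & HS & HT & EU).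
  exists b'; repeat split; [rewrite Ec; ev; exact E2 | now exists T |].
  intros U' (b1 & b2 & S' & T' & E1' & E2' & HS' & HT' & ->).
  assert (b2 = b') as -> by congruence.
  exists T'; split; [exact HT'|]; intros q Hq; exists ⟨p2, q⟩; split.
  + rewrite Ed; ev; reflexivity.
  + right; eauto.
- intros h; rewrite !eW_leE.
  intros (l & m & Ml & Mm & H) (l' & m' & Ml' & Mm' & H').
  real (tpair (Ap (K l) (V 0)) (Ap (K l') (V 0))) c Mc Ec.
  real (Ap (Ap (t1 (t2 (V 0))) (K ⟨m, m'⟩)) (tpair (t1 (V 0)) (t2 (t2 (V 0))))) d Md Ed.
  exists c, d; repeat split; auto; intros x a N.
  destruct (H _ _ N) as (b & Eb & [S0 HS0] & Hb), (H' _ _ N) as (b' & Eb' & [T0 HT0] & Hb').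
  assert (Hm : forall S T, f x b S -> g x b' T -> eW_meet f g x ⟨b, b'⟩ (tagged_sum S T)).
  { intros S T HS HT; exists b, b', S, T; repeat split; auto using pr_1E, pr_2E. }
  exists ⟨b, b'⟩; repeat split.
  + rewrite Ec; ev; rewrite Eb, Eb'; apply pairE.
  + eexists; apply Hm; eassumption.
  + intros U HU; destruct (Hb _ HU) as (S & HS & RS), (Hb' _ HU) as (T & HT & RT).
    exists (tagged_sum S T); split; [now apply Hm|].
    intros q [(q' & Hq & ->)|(q' & Hq & ->)]; rewrite Ed; ev; auto.
Qed.

Lemma eW_reindex_meet X Y (h : hom X Y) (f g : eW_elt Y) :
  ple (p := eW_preorder X) (eW_meet (eW_reindex h f) (eW_reindex h g))
    (eW_reindex h (eW_meet f g)).
Proof.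
real (tpair (t1 (V 0)) (tpair (t2 (t1 (t2 (V 0)))) (t2 (t2 (t2 (V 0)))))) c Mc Ec.
apply (@eW_le_simple X _ _ c Mc).
intros x a U (b & b' & S & T & E1 & E2 & (_ & d & Ed & HS) & (_ & d' & Ed' & HT) & ->).
exists ⟨pa_map X x, ⟨d, d'⟩⟩; split.
- rewrite Ec; ev; rewrite E1, E2, Ed, Ed'; ev; reflexivity.
- split; [apply pr_1E|]; exists ⟨d, d'⟩; split; [apply pr_2E|].
  exists d, d', S, T; repeat split; auto using pr_1E, pr_2E.
Qed.

Definition eW_pre : predoctrine ParAsm :=
  @PreDoctrine ParAsm eW_preorder eW_reindex eW_reindex_mono eW_reindex_id eW_reindex_comp
    eW_top eW_topP eW_reindex_top eW_meet eW_meetP eW_reindex_meet.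

Definition eW : doctrine ParAsm := reflect_doctrine eW_pre.

Definition eW_poset (X : ParAsm) : infsl := eW X.

Definition eW_map (X Y : ParAsm) (h : hom Y X) : infsl_hom (eW_poset X) (eW_poset Y) :=
  @fmap (opposite ParAsm) InfSl eW X Y h.

End Doctrines.

(* Main.v *)
Require Import Defs.
From Stdlib Require Import Relation_Operators ClassicalEpsilon.

Set Implicit Arguments.
Unset Strict Implicit.
Unset Printing Implicit Defensive.

(** An instance reducibility [(f : (Y, psi) -> (X, phi), alpha)] becomes the
    extended Weihrauch predicate [(x, a) |-> {alpha y | f y = x, psi y = a}].
    A realizer of a morphism over [X] is exactly a forward Weihrauch functional,
    since the name of [x] is computable from that of [y]; the morphism itself is
    recovered from the Weihrauch reduction with choice.  Conversely a predicate
    [F] is represented by the assembly of all triples [(x, a, S)] with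
    [S] in [F x a], named by [(phi x, a)]. *)

(** Since [f] reflects the order, monotonicity of [g] and [g (f x)] being equivalent to [x] both
    follow from [fgK] by comparing images under [f]. *)
Lemma pclass_map_poset_iso (P Q : preorder) (f : P -> Q)
    (fm : forall x y, ple x y -> ple (f x) (f y)) (g : Q -> P) :
  (forall x y, ple (f x) (f y) -> ple x y) ->
  (forall y, peq (f (g y)) y) ->
  poset_iso (P := reflection P) (Q := reflection Q) (pclass_map fm).
Proof.
intros fr fgK; split.
- intros c d; destruct (pclassP c) as [x ->], (pclassP d) as [y ->].
  simpl; rewrite !pclass_mapE, !pclass_leE; split; auto.
- assert (gm : forall x y, ple x y -> ple (g x) (g y)).
  { intros x y H; apply fr; apply ple_trans with x; [apply fgK|].
    apply ple_trans with y; [exact H | apply fgK]. }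
  exists (pclass_map gm); split; intros c; destruct (pclassP c) as [x ->];
    rewrite !pclass_mapE; apply class_of_eq.
  + split; apply fr, fgK.
  + apply fgK.
Qed.

Lemma poset_iso_is_top (P Q : preorder) (f : P -> Q) :
  poset_iso f -> forall t, is_top t -> is_top (f t).
Proof.
intros (fE & g & _ & gK) t Ht y; rewrite <- (gK y); apply fE, Ht.
Qed.

Lemma poset_iso_is_meet (P Q : preorder) (f : P -> Q) :
  poset_iso f -> forall x y m, is_meet x y m -> is_meet (f x) (f y) (f m).
Proof.
intros (fE & g & _ & gK) x y m (H1 & H2 & H3); repeat split; try now apply fE.
intros z; rewrite <- (gK z), <- !fE; apply H3.
Qed.

Definition poset_iso_hom (P Q : infsl) (f : P -> Q) (H : poset_iso f) : infsl_hom P Q :=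
  InfSlHom (fun x y => proj1 (proj1 H x y)) (poset_iso_is_top H) (poset_iso_is_meet H).

Lemma poset_iso_inverse (P Q : preorder) (f : P -> Q) (g : Q -> P) :
  poset_iso f -> (forall x, g (f x) = x) -> (forall y, f (g y) = y) -> poset_iso g.
Proof.
intros [fE _] fK gK; split; [|now exists f].
intros x y; rewrite (fE (g x)), !gK; reflexivity.
Qed.

(** Order isomorphisms preserve infima, so each component is a morphism of [InfSl]. The inverses
    exist only propositionally, fibre by fibre; choice assembles them into a family. *)
Lemma poset_isos_isomorphic_doctrines (C : category) (D E : doctrine C)
    (Phi : forall X : C, isl_pre (D X) -> isl_pre (E X)) :
  (forall X, poset_iso (Phi X)) ->
  (forall (X Y : C) (h : @hom (opposite C) X Y) (r : isl_pre (D X)),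
     Phi Y (ihom (fmap D h) r) = ihom (fmap E h) (Phi X r)) ->
  isomorphic_doctrines D E.
Proof.
intros HPhi Hnat.
pose (inv X := constructive_indefinite_description _ (proj2 (HPhi X))).
pose (to X := poset_iso_hom (HPhi X)).
pose (from X := poset_iso_hom (poset_iso_inverse (HPhi X)
                  (proj1 (proj2_sig (inv X))) (proj2 (proj2_sig (inv X))))).
constructor; refine (@NatIso (opposite C) InfSl D E to from _ _ _); intros.
- apply infsl_hom_ext, (proj1 (proj2_sig (inv X))).
- apply infsl_hom_ext, (proj2 (proj2_sig (inv X))).
- apply infsl_hom_ext, Hnat.
Qed.

Section Comparison.
Variables (A : pca) (A' : subpca A) (pr : pairing A').

Local Notation "⟨ a , b ⟩" := (pair pr a b).
Local Notation ParAsm := (ParAsm A').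
Local Notation π1 := (t1 pr).
Local Notation π2 := (t2 pr).

Local Ltac ev := cbn [eval tpair t1 t2];
  repeat (rewrite pairE || rewrite pr_1E || rewrite pr_2E).
Local Ltac real t l M E := destruct (@realize A A' t) as [l [M E]];
  [simpl; intuition auto using pr_p_mem, pr_1_mem, pr_2_mem|].

Definition eW_of_iR (X : ParAsm) (r : iR_elt A' X) : eW_elt X := fun x a S =>
  exists y : pa_car (ir_dom r), ir_map r y = x /\ pa_map (ir_dom r) y = a /\ S = ir_val y.

(** The question attached to [y] is its own name, so the backward functional receives exactly the
    pair on which [l] acts; a single [extW_le] step suffices. *)
Lemma eW_of_iR_mono (X : ParAsm) (r s : iR_preorder pr X) :
  ple r s -> ple (p := eW_preorder pr X) (eW_of_iR r) (eW_of_iR s).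
Proof.
intros (h & Eh & l & Ml & Hl); apply rt_step.
destruct (pah_tracked h) as [t [Mt Et]].
real (Ap (K t) (π2 (V 0))) c Mc Ec.
exists c, l; repeat split; auto; intros x a (S & y & <- & <- & _).
exists (pa_map (ir_dom s) (h y)); rewrite Eh; repeat split.
- rewrite Ec; ev; apply Et.
- now exists (ir_val (h y)), (h y).
(* The new question was computed from [y], while [S'] may come from another point [z] with the same
   name; [h z] and [h y] then share a name, as [t] computes both from that one. *)
- intros S' (z & E1 & E2 & ->); exists (ir_val (h z)); split.
  + exists (h z); repeat split; [now rewrite <- E1, Eh|].
    enough (Some (pa_map (ir_dom s) (h z)) = Some (pa_map (ir_dom s) (h y))) by congruence.
    now rewrite <- !Et, E2.
  + intros q Hq; rewrite <- E2; now apply Hl.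
Qed.

(** Working with [extW_uniform] gives both functionals access to the name of the base point, which
    the tracker [t] of [ir_map r] recomputes from the name of [y]. *)
Lemma eW_of_iR_reflects (X : ParAsm) (r s : iR_preorder pr X) :
  ple (p := eW_preorder pr X) (eW_of_iR r) (eW_of_iR s) -> ple r s.
Proof.
rewrite eW_leE; intros (l & m & Ml & Mm & H).
assert (Hz : forall y : pa_car (ir_dom r), exists z : pa_car (ir_dom s),
  ir_map s z = ir_map r y /\
  Some l • Some ⟨pa_map X (ir_map r y), pa_map (ir_dom r) y⟩ = Some (pa_map (ir_dom s) z) /\
  forall q, ir_val z q ->
    oin (Some m • Some ⟨⟨pa_map X (ir_map r y), pa_map (ir_dom r) y⟩, q⟩) (ir_val y)).
{ intros y.
  (* Query the reduction at the name of [y] with [ir_val y] as the set to be answered; the set [T]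
     it returns is the value of some [z]. *)
  assert (Hy : eW_of_iR r (ir_map r y) (pa_map (ir_dom r) y) (ir_val y)) by now exists y.
  destruct (H _ _ (ex_intro _ _ Hy)) as (b & Eb & _ & Hb).
  destruct (Hb _ Hy) as (T & (z & E1 & <- & ->) & Hq); now exists z. }
pose (h y := proj1_sig (constructive_indefinite_description _ (Hz y))).
assert (hP := fun y => proj2_sig (constructive_indefinite_description _ (Hz y))).
fold h in hP; cbn beta in hP.
destruct (pah_tracked (ir_map r)) as [t [Mt Et]].
assert (ht : tracked A' h).
{ real (Ap (K l) (tpair pr (Ap (K t) (V 0)) (V 0))) c Mc Ec.
  exists c; split; [exact Mc|]; intros y; rewrite Ec; ev; rewrite Et; ev; apply hP. }
exists (ParAsmHom ht); split.
- apply parasm_hom_ext; intros y; symmetry; apply hP.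
- real (Ap (K m) (tpair pr (tpair pr (Ap (K t) (π1 (V 0))) (π1 (V 0))) (π2 (V 0)))) c Mc Ec.
  exists c; split; [exact Mc|]; intros y q Hq; rewrite Ec; ev; rewrite Et; ev.
  now apply hP.
Qed.

(** The answer set is part of the point because [ir_val] gives one set per point, whereas [F] may
    give many per question; such points share a name. *)
Record instance (X : ParAsm) (F : eW_elt X) := Instance {
  ins_pt : pa_car X;
  ins_arg : A;
  ins_val : A -> Prop;
  ins_in : F ins_pt ins_arg ins_val }.

Definition iR_of_eW_dom (X : ParAsm) (F : eW_elt X) : parasm_ob A :=
  @ParAsmOb A (instance F) (fun i => ⟨pa_map X (ins_pt i), ins_arg i⟩).

Lemma ins_pt_tracked (X : ParAsm) (F : eW_elt X) :
  tracked A' (X := iR_of_eW_dom F) (Y := X) (@ins_pt X F).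
Proof. exists (pr_1 pr); split; [apply pr_1_mem | intros; apply pr_1E]. Qed.

Definition iR_of_eW (X : ParAsm) (F : eW_elt X) : iR_elt A' X :=
  IRElt (ParAsmHom (ins_pt_tracked F)) (@ins_val X F).

Lemma iR_of_eWK (X : ParAsm) (F : eW_preorder pr X) :
  peq (P := eW_preorder pr X) (eW_of_iR (iR_of_eW F)) F.
Proof.
split.
- real (π2 (π2 (V (A := A) 0))) c Mc Ec.
  apply (@eW_le_simple _ _ _ X _ _ c Mc); intros x a S ([x' b S' HF] & <- & <- & ->).
  exists b; split; [rewrite Ec; simpl pa_map; ev; reflexivity | exact HF].
- real (V (A := A) 0) c Mc Ec.
  apply (@eW_le_simple _ _ _ X _ _ c Mc); intros x a S HF.
  exists ⟨pa_map X x, a⟩; split; [apply Ec|].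
  now exists (Instance HF).
Qed.

(** Names in the pullback are pairs of names, matching the coding in [eW_reindex]. The answer sets
    agree, but the right side also accepts codes that merely have the right projections; these are
    paired anew. *)
Lemma eW_of_iR_reindex (X Y : ParAsm) (h : hom Y X) (r : iR_elt A' X) :
  peq (P := eW_preorder pr Y) (eW_of_iR (iR_reindex pr h r)) (eW_reindex pr h (eW_of_iR r)).
Proof.
split.
- real (π2 (V (A := A) 0)) c Mc Ec.
  apply (@eW_le_simple _ _ _ Y _ _ c Mc).
  intros x a S ([[x' y] E] & <- & <- & ->); simpl in E.
  eexists; split; [rewrite Ec; ev; reflexivity|].
  split; [apply pr_1E|]; eexists; split; [apply pr_2E|].
  now exists y.
- real (tpair pr (π1 (V 0)) (π2 (π2 (V 0)))) c Mc Ec.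
  apply (@eW_le_simple _ _ _ Y _ _ c Mc).
  intros x a S (_ & b & Eb & y & E & <- & ->).
  exists ⟨pa_map Y x, pa_map (ir_dom r) y⟩; split.
  + rewrite Ec; ev; rewrite Eb; ev; reflexivity.
  + now exists (exist (fun yz => h (fst yz) = ir_map r (snd yz)) (x, y) (eq_sym E)).
Qed.

End Comparison.

Theorem theorem5p3 (A : pca) (A' : subpca A) (pr : pairing A') :
  (exists Phi : forall X : ParAsm A', iR_poset pr X -> eW_poset pr X,
     (forall X : ParAsm A', poset_iso (Phi X)) /\
     (forall (X Y : ParAsm A') (h : hom Y X) (r : iR_poset pr X),
        Phi Y (iR_map pr h r) = eW_map pr h (Phi X r))) /\
  isomorphic_doctrines (iR pr) (eW pr).
Proof.
assert (H : exists Phi : forall X : ParAsm A', iR_poset pr X -> eW_poset pr X,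
     (forall X : ParAsm A', poset_iso (Phi X)) /\
     (forall (X Y : ParAsm A') (h : hom Y X) (r : iR_poset pr X),
        Phi Y (iR_map pr h r) = eW_map pr h (Phi X r))).
{ exists (fun X => pclass_map (@eW_of_iR_mono A A' pr X)); split.
  - intros X.
    exact (pclass_map_poset_iso _ (@eW_of_iR_reflects A A' pr X) (@iR_of_eWK A A' pr X)).
  - intros X Y h r; destruct (pclassP r) as [x ->]; simpl.
    rewrite !pclass_mapE; apply class_of_eq, eW_of_iR_reindex. }
split; [exact H|].
destruct H as (Phi & Hiso & Hnat).
exact (poset_isos_isomorphic_doctrines (D := iR pr) (E := eW pr) Hiso Hnat).
Qed.
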